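(* Let $\Lambda\subset\mathbb{R}^2\cong\mathbb{C}$ be a non-degenerate set with property (Aff), and let $m\in\mathbb{N}$ with $m\geq 3$. Then the following statements are equivalent: (i) There is an affinely regular $m$-gon in $\Lambda$. (ii) $\mathbb{k}_m\subset \mathbb{k}_\Lambda$. If $\Lambda$ additionally satisfies property (Alg), then $\Lambda$ contains affinely regular $m$-gons for only finitely many values of $m$.
   Context: $\mathbb{N}=\{1,2,3,\dots\}$. The plane $\mathbb{R}^2$ is identified with $\mathbb{C}$, and $\bar{\cdot}$ denotes complex conjugation. For $m\in\mathbb{N}$, $\zeta_m:=e^{2\pi i/m}$ and $\mathbb{k}_m:=\mathbb{Q}(\zeta_m+\bar\zeta_m)$, the maximal real subfield of $\mathbb{Q}(\zeta_m)$. For $\Lambda\subset\mathbb{C}$, let $\Lambda-\Lambda:=\{s-s' \mid s,s'\in\Lambda\}$ and define $\mathbb{K}_\Lambda:=\mathbb{Q}\big((\Lambda-\Lambda)\cup\overline{(\Lambda-\Lambda)}\big)\subset\mathbb{C}$ and $\mathbb{k}_\Lambda:=\mathbb{K}_\Lambda\cap\mathbb{R}$. The set $\Lambda$ is called degenerate if $\mathbb{K}_\Lambda\subset\mathbb{R}$, and non-degenerate otherwise. Property (Alg): $[\mathbb{K}_\Lambda:\mathbb{Q}]<\infty$. Property (Aff): for every finite subset $F$ of $\mathbb{K}_\Lambda$ there is a non-singular affine transformation $\Psi:\mathbb{R}^2\to\mathbb{R}^2$ (i.e. $z\mapsto Az+t$ with $A$ an invertible real $2\times2$ matrix and $t\in\mathbb{R}^2$)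 such that $\Psi(F)\subset\Lambda$. A polygon in a set $S\subset\mathbb{R}^2$ is a convex polygon (convex hull of a finite set of points) all of whose vertices lie in $S$. Regular polygons are assumed to be planar, non-degenerate and convex. An affinely regular polygon is the image of a regular polygon under a non-singular affine transformation of the plane; an affinely regular $m$-gon is one with exactly $m$ vertices. *)

(* Defs.v *)
From HB Require Import structures.
From mathcomp Require Import all_boot all_order all_algebra.
From mathcomp Require Export complex.
From mathcomp Require Import all_classical all_reals all_analysis.

Set Implicit Arguments.
Unset Strict Implicit.
Unset Printing Implicit Defensive.

Import Order.TTheory GRing.Theory Num.Theory.

Local Open Scope classical_set_scope.
Local Open Scope ring_scope.
Local Open Scope complex_scope.

(* Inversion is total with 0^-1 = 0, so closure under division is harmless
   at 0. *)
Definition is_subfield (F : fieldType) (K : set F) : Prop :=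
  divring_closed [pred x | x \in K].

(* Q(S): a subfield of a field of characteristic 0 contains Q, so this is the
   smallest subfield containing both Q and S. *)
Definition adjoinQ (F : numFieldType) (S : set F) : set F :=
  smallest (@is_subfield F) S.

(* [K : Q] < oo, i.e. K is finite-dimensional as a vector space over Q. *)
Definition finite_degreeQ (F : numFieldType) (K : set F) : Prop :=
  exists (d : nat) (e : 'I_d -> F),
    (forall i, K (e i)) /\
    (forall x, K x -> exists c : 'I_d -> rat, x = \sum_(i < d) ratr (c i) * e i).

Definition realsC (R : realType) : set R[i] := range (fun x : R => x%:C).
Arguments realsC : clear implicits.

(* e^(2 pi i / m), by Euler's formula *)
Definition zeta (R : realType) (m : nat) : R[i] :=
  cos (2 * pi / m%:R) +i* sin (2 * pi / m%:R).

Definition k_cyclo (R : realType) (m : nat) : set R[i] :=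
  adjoinQ [set zeta R m + conjc (zeta R m)].
Arguments k_cyclo : clear implicits.

Definition difference_set (V : zmodType) (L : set V) : set V :=
  [set s - s' | s in L & s' in L].

Definition K_Lambda (R : realType) (L : set R[i]) : set R[i] :=
  adjoinQ (difference_set L `|` [set conjc z | z in difference_set L]).

Definition k_Lambda (R : realType) (L : set R[i]) : set R[i] := K_Lambda L `&` realsC R.

Definition degenerate (R : realType) (L : set R[i]) : Prop := K_Lambda L `<=` realsC R.

Definition vec_of_complex (R : realType) (z : R[i]) : 'cV[R]_2 :=
  \col_(i < 2) (if i == ord0 then complex.Re z else complex.Im z).

Definition complex_of_vec (R : realType) (u : 'cV[R]_2) : R[i] :=
  u ord0 ord0 +i* u ord_max ord0.

Definition affine_map (R : realType) (A : 'M[R]_2) (t z : R[i]) : R[i] :=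
  complex_of_vec (A *m vec_of_complex z) + t.

Definition nonsingular_affine (R : realType) (Psi : R[i] -> R[i]) : Prop :=
  exists (A : 'M[R]_2) (t : R[i]), A \in unitmx /\ Psi = affine_map A t.

Definition prop_Alg (R : realType) (L : set R[i]) : Prop := finite_degreeQ (K_Lambda L).

Definition prop_Aff (R : realType) (L : set R[i]) : Prop :=
  forall F : set R[i], finite_set F -> F `<=` K_Lambda L ->
    exists2 Psi, nonsingular_affine Psi & Psi @` F `<=` L.

(* Rcomplex R is R[i] with its structure of real vector space. *)
Definition convex_hull (R : realType) (S : set R[i]) : set R[i] :=
  smallest (@convex_set R (Rcomplex R)) S.

(* Vertices of a convex polygon P: the points of P that are not interior to a
   segment with endpoints in P. *)
Definition vertices (R : realType) (P : set R[i]) : set R[i] :=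
  [set x | P x /\ forall (y z : R[i]) (t : R), P y -> P z -> 0 < t < 1 ->
     x = t%:C * y + (1 - t)%:C * z -> y = x /\ z = x].

Definition polygon (R : realType) (P : set R[i]) : Prop :=
  exists2 F : set R[i], finite_set F & P = convex_hull F.

Definition polygon_in (R : realType) (S P : set R[i]) : Prop :=
  polygon P /\ vertices P `<=` S.

Definition dotC (R : realType) (u v : R[i]) : R := complex.Re (u * conjc v).
Definition crossC (R : realType) (u v : R[i]) : R := complex.Im (conjc u * v).

(* Angle at b of the triangle a b c, in [0, pi] *)
Definition angle (R : realType) (a b c : R[i]) : R :=
  acos (dotC (a - b) (c - b) / (Normc.normc (a - b) * Normc.normc (c - b))).

(* v lists the vertices of a non-degenerate convex n-gon in counterclockwise
   order: every other vertex lies strictly to the left of the directed line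
   through an edge (v i, v (i+1)); indices are modulo n. *)
Definition convex_position (R : realType) (n : nat) (v : 'I_n -> R[i]) : Prop :=
  forall i k : 'I_n, k != i -> k != ordS i ->
    0 < crossC (v (ordS i) - v i) (v k - v i).

Definition equilateral (R : realType) (n : nat) (v : 'I_n -> R[i]) : Prop :=
  forall i j : 'I_n, Normc.normc (v (ordS i) - v i) = Normc.normc (v (ordS j) - v j).

Definition equiangular (R : realType) (n : nat) (v : 'I_n -> R[i]) : Prop :=
  forall i j : 'I_n, angle (v (ord_pred i)) (v i) (v (ordS i)) =
                     angle (v (ord_pred j)) (v j) (v (ordS j)).

Definition regular_polygon (R : realType) (P : set R[i]) : Prop :=
  exists (n : nat) (v : 'I_n -> R[i]),
    [/\ (3 <= n)%N, convex_position v, equilateral v, equiangular v &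
        P = convex_hull (range v)].

Definition affinely_regular (R : realType) (P : set R[i]) : Prop :=
  exists2 Psi : R[i] -> R[i], nonsingular_affine Psi &
    exists2 Q, regular_polygon Q & P = Psi @` Q.

Definition affinely_regular_gon (R : realType) (m : nat) (P : set R[i]) : Prop :=
  affinely_regular P /\ (vertices P #= `I_m)%card.

(* Main.v *)
Require Import Defs.
From mathcomp Require Import all_boot all_order all_algebra.
From mathcomp Require Import all_field ring lra.
From mathcomp Require Import complex.
From mathcomp Require Import all_classical all_reals all_analysis.

(* A regular n-gon has vertices c + a w^k with w a primitive n-th root of unity.
   Its consecutive edges satisfy e_2 + e_0 = (w + 1/w) e_1, a relation with a
   real coefficient, so it survives affine maps; when the image has its vertices
   in L, w + 1/w is a quotient of elements of K_L.  Since zeta is a power of w,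
   zeta + 1/zeta is an integer polynomial in w + 1/w.

   Conversely, each zeta^k is p_k + q_k zeta with p_k, q_k in Z[zeta + 1/zeta].
   Non-degeneracy provides a non-real tau in K_L, and the R-linear map with
   1 |-> 1 and zeta |-> Re zeta + tau sends every zeta^k into K_L; property
   (Aff) then moves these finitely many points into L.

   If [K_L : Q] = d, then zeta + 1/zeta is a root of a nonzero rational
   polynomial of degree at most d, so zeta is a root of one of degree at most
   2d.  Irreducibility of the cyclotomic polynomials gives phi(m) <= 2d, which
   bounds m. *)

Set Implicit Arguments.
Unset Strict Implicit.
Unset Printing Implicit Defensive.

Import Order.TTheory GRing.Theory Num.Theory.

Local Open Scope classical_set_scope.
Local Open Scope ring_scope.
Local Open Scope complex_scope.

(** * Cyclotomic degrees *)

(* If totient m <= N, then every prime power p ^ e exactly dividing m satisfies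
   p - 1 <= N and e <= N. *)
Lemma totient_le_bounded (N m : nat) : (totient m <= N)%N -> (m <= N.+1`! ^ N)%N.
Proof.
have [-> // | m_gt0 le_mN] := posnP m.
have M_gt0 : (0 < N.+1`! ^ N)%N by rewrite expn_gt0 fact_gt0.
(* It suffices that m divides the bound, which is checked prime by prime on the valuations. *)
apply: dvdn_leq => //; apply/gcdn_idPl; apply: eqn_from_log => //.
  by rewrite gcdn_gt0 m_gt0.
move=> p; rewrite logn_gcd //; apply/minn_idPl.
have [-> // | e_gt0] := posnP (logn p m).
have mp : p \in primes m by rewrite -logn_gt0.
have p_pr : prime p by move: mp; rewrite mem_primes => /andP[].
have p1_gt0 : (0 < p.-1)%N by rewrite -subn1 subn_gt0 prime_gt1.
have le_pN : (p.-1 * p ^ (logn p m).-1 <= N)%N.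
  apply: leq_trans le_mN; apply: dvdn_leq; first by rewrite totient_gt0.
  by rewrite (totientE m_gt0) (big_rem p) //= dvdn_mulr.
have p_leN : (p <= N.+1)%N.
  rewrite -(prednK (prime_gt0 p_pr)) ltnS; apply: leq_trans le_pN.
  by rewrite leq_pmulr // expn_gt0 prime_gt0.
have e_leN : (logn p m <= N)%N.
  rewrite -(prednK e_gt0); apply: leq_trans le_pN.
  by apply: leq_trans (leq_pmull _ p1_gt0); rewrite ltn_expl ?prime_gt1.
(* Since p <= N + 1, p divides (N + 1)!; since e <= N, p^e divides its N-th power. *)
rewrite -pfactor_dvdn //; apply: dvdn_trans (dvdn_exp2l p e_leN) _.
by rewrite dvdn_exp2r // dvdn_fact // prime_gt0.
Qed.

Lemma root_prod (R : idomainType) (I : Type) (r : seq I) (f : I -> {poly R}) (x : R) :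
  root (\prod_(i <- r) f i) x = has (fun i => root (f i) x) r.
Proof. by rewrite rootE horner_prod prodf_seq_eq0. Qed.

(** X^n - 1 is the product of the ['Phi_d] over d dividing n, so z is a root of one of them; then
    z^d = 1, and primitivity forces d = n. *)
Lemma root_Cyclotomic (F : fieldType) (n : nat) (z : F) :
  n.-primitive_root z -> root (map_poly intr 'Phi_n) z.
Proof.
move=> prim_z; have n_gt0 := prim_order_gt0 prim_z.
have dvd_1 d : (0 < d)%N ->
    \prod_(e <- divisors d) map_poly intr 'Phi_e = 'X^d - 1 :> {poly F}.
  move=> d_gt0; rewrite -rmorph_prod prod_Cyclotomic //.
  by rewrite rmorphB rmorph1 /= map_polyXn.
have: root (\prod_(e <- divisors n) map_poly intr 'Phi_e) z.
  by rewrite dvd_1 // rootE !hornerE prim_expr_order // subrr.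
rewrite root_prod => /hasP[d]; rewrite -dvdn_divisors // => dvd_dn /= root_d.
have d_gt0 := dvdn_gt0 n_gt0 dvd_dn.
suff /eqP-> : n == d by [].
rewrite eqn_dvd dvd_dn andbT (prim_order_dvd prim_z).
have: root ('X^d - 1) z.
  rewrite -dvd_1 // root_prod; apply/hasP; exists d => //.
  by rewrite -dvdn_divisors.
by rewrite rootE !hornerE subr_eq0.
Qed.

(** ['Phi_n] is irreducible over Q, so its gcd with q is constant or a multiple of ['Phi_n]; the
    common root z excludes a constant. *)
Lemma root_Cyclotomic_dvdp (F : numFieldType) (n : nat) (z : F) (q : {poly rat}) :
  n.-primitive_root z -> root (map_poly ratr q) z -> map_poly intr 'Phi_n %| q.
Proof.
move=> prim_z qz0; have n_gt0 := prim_order_gt0 prim_z.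
set p : {poly rat} := map_poly intr 'Phi_n.
have pE (K : numFieldType) : map_poly ratr p = map_poly intr 'Phi_n :> {poly K}.
  by rewrite -map_poly_comp; apply: eq_map_poly => b; rewrite /= ratr_int.
have p_neq0 : p != 0.
  by rewrite monic_neq0 // monic_map // Cyclotomic_monic.
(* Irreducibility is read off in [algC], where p is the minimal polynomial of a primitive root y: y
   is a root of f or of its cofactor g, and in the second case p divides g, so f divides 1. *)
have p_irr (f : {poly rat}) : f %| p -> p %| f \/ size f = 1%N.
  have [y prim_y] := C_prim_root_exists n_gt0.
  have [p' [Dp' _] p'_dvd] := minCpolyP y.
  have Dp : p = p'.
    apply: (@map_poly_inj _ algC ratr); rewrite -Dp' pE.
    by rewrite (minCpoly_cyclotomic prim_y) (Cintr_Cyclotomic prim_y).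
  have /root_Cyclotomic py := prim_y; rewrite -pE in py.
  case/dvdpP => g Dpfg; move: py; rewrite Dpfg rmorphM rootM /= -Dpfg.
  rewrite !p'_dvd -Dp => /orP[p_g|]; last by left.
  right; apply/eqP; rewrite -dvdp1.
  have g_neq0 : g != 0 by apply: contra_neq p_neq0; rewrite Dpfg => ->; rewrite mul0r.
  by rewrite -(@dvdp_mul2l _ g) // mulr1 -Dpfg.
have [//|p_gcd|] := p_irr (gcdp p q); first exact: dvdp_gcdl.
  exact: dvdp_trans p_gcd (dvdp_gcdr _ _).
move=> gcd1; have: root (map_poly ratr (gcdp p q)) z.
  by rewrite gcdp_map root_gcd qz0 pE root_Cyclotomic.
have /size_poly1P[c c_neq0 ->] := introT eqP gcd1.
by rewrite map_polyC rootC fmorph_eq0 (negPf c_neq0).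
Qed.

Lemma totient_lt_size (F : numFieldType) (n : nat) (z : F) (q : {poly rat}) :
  n.-primitive_root z -> q != 0 -> root (map_poly ratr q) z ->
  (totient n < size q)%N.
Proof.
move=> prim_z q_neq0 /(root_Cyclotomic_dvdp prim_z) /(dvdp_leq q_neq0).
by rewrite size_map_inj_poly ?size_Cyclotomic //; exact: intr_inj.
Qed.

(* Clearing denominators in p (z + 1/z). *)
Lemma root_addV (F : numFieldType) (z : F) (p : {poly rat}) :
  z != 0 -> p != 0 -> root (map_poly ratr p) (z + z^-1) ->
  exists q : {poly rat},
    [/\ q != 0, (size q < (size p).*2)%N & root (map_poly ratr q) z].
Proof.
move=> z_neq0 p_neq0 pz; have [n szp] : exists n, size p = n.+1.
  by exists (size p).-1; rewrite prednK // size_poly_gt0.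
(* Chosen so that q(z) = z^n p(z + 1/z), with n the degree of p. *)
pose q : {poly rat} := \sum_(i < n.+1) p`_i *: (('X^2 + 1) ^+ i * 'X^(n - i)).
exists q; split.
(* At 0 only the term i = n survives, so the constant coefficient of q is the leading coefficient of
   p. *)
- apply/eqP => q0; have := congr1 (fun f : {poly rat} => f.[0]) q0.
  rewrite /q horner_sum horner0 big_ord_recr /= subnn big1 ?add0r; last first.
    by move=> i _; rewrite !hornerE expr0n subn_eq0 leqNgt ltn_ord /= mulr0.
  rewrite !hornerE /= expr1n !mulr1 => /eqP.
  by rewrite -[n]/n.+1.-1 -szp lead_coef_eq0 (negPf p_neq0).
- rewrite szp doubleS ltnS; apply: leq_trans (size_sum _ _ _) _.
  apply/bigmax_leqP => i _; apply: leq_trans (size_scale_leq _ _) _.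
  apply: leq_trans (size_polyMleq _ _) _; rewrite size_polyXn addnS /=.
  have szi : (size (('X^2 + 1 : {poly rat}) ^+ i) <= (i.*2).+1)%N.
    apply: leq_trans (size_poly_exp_leq _ _) _.
    by rewrite -['X^2 + 1]/('X^2 + 1%:P) size_XnaddC // mul2n.
  apply: leq_trans (leq_add szi (leqnn _)) _.
  have le_in : (i <= n)%N by rewrite -ltnS.
  by rewrite addSn ltnS -addnn -addnA subnKC // -addnn leq_add2r.
- move: pz; rewrite !rootE (@horner_coef_wide _ n.+1) ?size_map_poly ?szp //.
  move=> /eqP p0.
  rewrite /q rmorph_sum horner_sum /=.
  suff -> : \sum_(i < n.+1)
      (map_poly ratr (p`_i *: (('X^2 + 1) ^+ i * 'X^(n - i)))).[z] =
     z ^+ n * \sum_(i < n.+1) (map_poly ratr p)`_i * (z + z^-1) ^+ i.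
    by rewrite p0 mulr0.
  rewrite mulr_sumr; apply: eq_bigr => i _.
  rewrite map_polyZ rmorphM rmorphXn rmorphD /= !map_polyXn rmorph1 !hornerE.
  have zz : z ^+ 2 + 1 = z * (z + z^-1) by rewrite mulrDr mulfV // expr2.
  have zn : z ^+ n = z ^+ i * z ^+ (n - i) by rewrite -exprD subnKC // -ltnS.
  rewrite coef_map /= zz exprMn zn; ring.
Qed.

(** The d + 1 powers 1, x, ..., x^d have coordinate rows in Q^d; a nonzero vector in the left kernel
    of the coordinate matrix lists the coefficients of p. *)
Lemma linear_dependence_powers (F : numFieldType) (d : nat) (e : 'I_d -> F) (x : F)
    (c : 'I_d.+1 -> 'I_d -> rat) :
  (forall k : 'I_d.+1, x ^+ k = \sum_(i < d) ratr (c k i) * e i) ->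
  exists p : {poly rat}, [/\ p != 0, (size p <= d.+1)%N & root (map_poly ratr p) x].
Proof.
move=> xE; pose C : 'M[rat]_(d.+1, d) := \matrix_(k, i) c k i.
have : kermx C != 0.
  rewrite -mxrank_eq0 mxrank_ker -lt0n subn_gt0.
  exact: leq_ltn_trans (rank_leq_col C) _.
case/rowV0Pn => v /sub_kermxP vC v_neq0.
exists (rVpoly v); split.
- by apply: contra_neq v_neq0 => v0; rewrite -[v]rVpolyK v0 linear0.
- exact: size_poly.
- rewrite rootE (@horner_coef_wide _ d.+1) ?size_map_poly ?size_poly //.
  transitivity (\sum_(i < d) ratr ((v *m C) 0 i) * e i == 0); last first.
    by rewrite vC big1 ?eqxx // => i _; rewrite mxE rmorph0 mul0r.
  congr (_ == 0); under eq_bigr => k _ do rewrite coef_map coef_rVpoly_ord xE mulr_sumr.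
  rewrite exchange_big; apply: eq_bigr => i _ /=.
  rewrite mxE rmorph_sum mulr_suml; apply: eq_bigr => k _ /=.
  by rewrite mxE rmorphM mulrA.
Qed.

(** * Subfields *)

Section Subfields.
Variables (F : fieldType) (K : set F).
Hypothesis fieldK : is_subfield K.

Lemma subfield1 : K 1.
Proof. by case: fieldK => + _ _; rewrite inE. Qed.

Lemma subfieldB x y : K x -> K y -> K (x - y).
Proof.
case: fieldK => _ subK _ Kx Ky; have := subK x y.
by rewrite !inE; apply.
Qed.

Lemma subfield_div x y : K x -> K y -> K (x / y).
Proof.
case: fieldK => _ _ divK Kx Ky; have := divK x y.
by rewrite !inE; apply.
Qed.

Lemma subfield0 : K 0.
Proof. by rewrite -(subrr 1); apply: subfieldB; exact: subfield1. Qed.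

Lemma subfieldD x y : K x -> K y -> K (x + y).
Proof.
move=> Kx Ky; rewrite -[y]opprK -[- y]sub0r.
by apply: subfieldB => //; apply: subfieldB => //; exact: subfield0.
Qed.

Lemma subfieldM x y : K x -> K y -> K (x * y).
Proof.
move=> Kx Ky; rewrite -[y]invrK -[y^-1]mul1r.
by apply: subfield_div => //; apply: subfield_div => //; exact: subfield1.
Qed.

Lemma subfieldX x n : K x -> K (x ^+ n).
Proof.
move=> Kx; elim: n => [|n IHn]; first exact: subfield1.
by rewrite exprS; apply: subfieldM.
Qed.

End Subfields.

Lemma is_subfieldP (F : fieldType) (K : set F) :
  K 1 -> (forall x y, K x -> K y -> K (x - y)) ->
  (forall x y, K x -> K y -> K (x / y)) -> is_subfield K.
Proof.
move=> K1 KB KV; split; first by rewrite inE.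
  by move=> x y; rewrite !inE; exact: KB.
by move=> x y; rewrite !inE; exact: KV.
Qed.

Lemma adjoinQ_subfield (F : numFieldType) (S : set F) : is_subfield (adjoinQ S).
Proof.
apply: is_subfieldP => [A [Af _]|x y Kx Ky A [Af SA]|x y Kx Ky A [Af SA]].
- exact: subfield1.
- by apply: subfieldB => //; [apply: Kx | apply: Ky].
- by apply: subfield_div => //; [apply: Kx | apply: Ky].
Qed.

Lemma realsCI_subfield (R : realType) (K : set R[i]) :
  is_subfield K -> is_subfield (K `&` realsC R).
Proof.
move=> Kf; apply: is_subfieldP.
- by split; [exact: subfield1|exists 1].
- move=> x y [Kx [a _ ax]] [Ky [b _ bY]]; split; first exact: subfieldB.
  by exists (a - b); rewrite // rmorphB /= ax bY.
- move=> x y [Kx [a _ ax]] [Ky [b _ bY]]; split; first exact: subfield_div.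
  by exists (a / b); rewrite // fmorph_div /= ax bY.
Qed.

(** * Convex hulls and affine maps *)

Section Hull.
Variable R : realType.
Implicit Types (S P : set R[i]) (x y z c : R[i]) (t r : R).

(** Convexity phrased as in [vertices]: complex multiplication and a parameter in the open unit
    interval. *)
Definition segment_closed S := forall x y t, 0 < t < 1 -> S x -> S y ->
  S (t%:C * x + (1 - t)%:C * y).

Lemma scale_RcomplexE (t : R) (x : R[i]) : t *: (x : Rcomplex R) = t%:C * x.
Proof. by case: x => a b; rewrite /= -[RHS]/(_ +i* _) !mul0r subr0 addr0. Qed.

Lemma convex_setP S : @convex_set R (Rcomplex R) S <-> segment_closed S.
Proof.
rewrite convex_setW; split=> cS x y.
- move=> t /andP[t0 t1] Sx Sy.
  have := cS x y (mem_set Sx) (mem_set Sy) (Itv01 (ltW t0) (ltW t1)) t0 t1.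
  by rewrite inE -!scale_RcomplexE.
- rewrite !inE => Sx Sy k k0 k1; have := cS x y k%:num _ Sx Sy.
  by rewrite k0 k1 -!scale_RcomplexE inE; apply.
Qed.

Lemma convex_hull_closed S : segment_closed (convex_hull S).
Proof.
move=> x y t t01 Sx Sy A [Ac SA].
by move/convex_setP: (Ac); apply=> //; [apply: Sx | apply: Sy].
Qed.

Lemma sub_convex_hull S : S `<=` convex_hull S.
Proof. exact: sub_gen_smallest. Qed.

Lemma convex_hull_min S P : segment_closed P -> S `<=` P -> convex_hull S `<=` P.
Proof. by move=> Pc SP; apply: smallest_sub => //; apply/convex_setP. Qed.

(** Removing an extreme point from a convex set leaves a convex set. If the point were not in S, the
    rest of the hull would contradict minimality. *)
Lemma vertices_convex_hull_sub S : vertices (convex_hull S) `<=` S.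
Proof.
move=> x [Sx ext_x]; apply: contrapT => nSx.
suff : (convex_hull S `\ x) x by case=> _; exact.
move: Sx; apply: convex_hull_min => [y z t t01 [Sy nyx] [Sz nzx]|y Sy].
  split; first exact: convex_hull_closed.
  by move=> yzx; have [yx _] := ext_x y z t Sy Sz t01 (esym yzx); exact: nyx.
by split; [exact: sub_convex_hull | move=> yx; apply: nSx; rewrite -yx].
Qed.

(** The squared modulus, polynomial in the coordinates and free of square roots, so that [ring] and
    [lra] apply. *)
Definition sqn (z : R[i]) : R := complex.Re z ^+ 2 + complex.Im z ^+ 2.

Lemma sqn_ge0 z : 0 <= sqn z.
Proof. by rewrite addr_ge0 ?sqr_ge0. Qed.

Lemma sqn_eq0 z : (sqn z == 0) = (z == 0).
Proof. by rewrite paddr_eq0 ?sqr_ge0 // !sqrf_eq0 eq_complex. Qed.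

Lemma sqnM x y : sqn (x * y) = sqn x * sqn y.
Proof. by case: x y => a b [c d]; rewrite /sqn /=; ring. Qed.

Lemma sqnE z : (sqn z)%:C = z * z^*.
Proof.
case: z => a b; apply/eqP; rewrite eq_complex /sqn /=.
by apply/andP; split; apply/eqP; ring.
Qed.

Lemma normc_sqn z : Normc.normc z = Num.sqrt (sqn z).
Proof. by case: z. Qed.

(* Stewart's identity, the quantitative form of the strict convexity of disks *)
Lemma sqn_conv x y t : sqn (t%:C * x + (1 - t)%:C * y) =
  t * sqn x + (1 - t) * sqn y - t * (1 - t) * sqn (x - y).
Proof. by case: x y => a b [c d]; rewrite /sqn /=; ring. Qed.

(** The hull lies in the closed disk of squared radius r, and a proper convex combination of two
    distinct points of the disk is strictly inside. *)
Lemma circle_vertices S c r : (forall x, S x -> sqn (x - c) = r) ->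
  S `<=` vertices (convex_hull S).
Proof.
move=> Sr.
have conv_sub x y t : t%:C * x + (1 - t)%:C * y - c = 
    t%:C * (x - c) + (1 - t)%:C * (y - c).
  by rewrite rmorphB rmorph1; ring.
have Dr x : convex_hull S x -> sqn (x - c) <= r.
  move: x; apply: convex_hull_min => [x y t /andP[t0 t1] xr yr|x /Sr-> //].
  have t1' : 0 < 1 - t by rewrite subr_gt0.
  have := mulr_ge0 (mulr_ge0 (ltW t0) (ltW t1')) (sqn_ge0 (x - c - (y - c))).
  have := ler_wpM2l (ltW t0) xr; have := ler_wpM2l (ltW t1') yr.
  rewrite conv_sub sqn_conv; lra.
move=> x Sx; split; first exact: sub_convex_hull.
move=> y z t /Dr yr /Dr zr /andP[t0 t1] xyz.
suff yz : y = z.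
  move: xyz; rewrite yz -mulrDl -rmorphD /= addrC subrK rmorph1 mul1r => ->.
  by [].
have := Sr x Sx; rewrite xyz conv_sub sqn_conv => xr.
(* As x is on the circle and y, z are in the disk, the defect t (1 - t) |y - z|^2 in Stewart's
   identity cannot be positive. *)
have : sqn (y - c - (z - c)) <= 0.
  have t1' : 0 < 1 - t by rewrite subr_gt0.
  have := ler_wpM2l (ltW t0) yr; have := ler_wpM2l (ltW t1') zr.
  rewrite -(pmulr_rle0 _ (mulr_gt0 t0 t1')); lra.
rewrite le_eqVlt ltNge sqn_ge0 orbF sqn_eq0 => /eqP yzc.
by apply/eqP; rewrite -subr_eq0 -yzc; apply/eqP; ring.
Qed.

End Hull.

(** * Affine maps in complex coordinates *)

Lemma det_mx22 (R : comPzRingType) (A : 'M[R]_2) :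
  \det A = A ord0 ord0 * A ord_max ord_max - A ord0 ord_max * A ord_max ord0.
Proof.
rewrite (expand_det_row A ord0) !big_ord_recl big_ord0 addr0 /cofactor !det_mx11 !mxE.
have -> : lift ord0 ord0 = ord_max :> 'I_2 by apply: val_inj.
have -> : lift ord_max 0 = ord0 :> 'I_2 by apply: val_inj.
by rewrite expr0 expr1 mul1r mulN1r mulrN.
Qed.

Section Affine.
Variable R : realType.
Implicit Types (u w t z : R[i]) (P S : set R[i]) (Psi : R[i] -> R[i]).

(** The R-linear map with 1 |-> u and i |-> w; its determinant is [crossC u w]. *)
Definition real_comb u w z : R[i] := (complex.Re z)%:C * u + (complex.Im z)%:C * w.

Lemma real_combB u w x y : real_comb u w (x - y) = real_comb u w x - real_comb u w y.
Proof. by case: x y => a b [c d]; rewrite /real_comb /= !rmorphB; ring. Qed.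

Lemma real_combD u w x y : real_comb u w (x + y) = real_comb u w x + real_comb u w y.
Proof. by case: x y => a b [c d]; rewrite /real_comb /= !rmorphD; ring. Qed.

Lemma real_combZ u w (r : R) z : real_comb u w (r%:C * z) = r%:C * real_comb u w z.
Proof.
by case: z => c d; rewrite /real_comb /= !mul0r subr0 addr0 !rmorphM; ring.
Qed.

(** Multiplicativity of the determinant: [crossC x y] is the determinant with columns x and y. *)
Lemma crossC_real_comb u w x y :
  crossC (real_comb u w x) (real_comb u w y) = crossC u w * crossC x y.
Proof.
move: u w x y => [u1 u2] [w1 w2] [x1 x2] [y1 y2].
by rewrite /crossC /real_comb /=; ring.
Qed.

Lemma real_comb_eq0 u w z : crossC u w != 0 -> real_comb u w z = 0 -> z = 0.
Proof.
move=> uw0 z0.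
have h y : crossC z y = 0.
  apply: (mulfI uw0); rewrite mulr0 -crossC_real_comb z0.
  by rewrite /crossC rmorph0 mul0r.
have := h 'i%C; have := h 1; case: z {z0 h} => a b.
by rewrite /crossC /= !(mulr0, mulr1, addr0, add0r) => /eqP; rewrite oppr_eq0 => /eqP-> ->.
Qed.

(** The columns of the matrix, read as complex numbers, are u and w; the later arguments use this
    form instead of matrices. *)
Lemma nonsingular_affineP Psi : nonsingular_affine Psi <->
  exists u w t, crossC u w != 0 /\ forall z, Psi z = real_comb u w z + t.
Proof.
have crossE u w : crossC u w = complex.Re u * complex.Im w - complex.Re w * complex.Im u.
  by move: u w => [u1 u2] [w1 w2]; rewrite /crossC /=; ring.
split=> [[A [t [uA ->]]]|[u [w [t [uw0 PsiE]]]]].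
- exists (A ord0 ord0 +i* A ord_max ord0), (A ord0 ord_max +i* A ord_max ord_max), t.
  split=> [|[a b]].
    by move: uA; rewrite unitmxE unitfE det_mx22 crossE; exact.
  rewrite /affine_map; congr (_ + _).
  rewrite /complex_of_vec /real_comb !mxE !big_ord_recl !big_ord0 !mxE /=.
  apply/eqP; rewrite eq_complex /=.
  have -> : lift ord0 ord0 = ord_max :> 'I_2 by apply: val_inj.
  by apply/andP; split; apply/eqP; ring.
- pose A : 'M[R]_2 := \matrix_(i, j)
    (let c := if j == ord0 then u else w in
     if i == ord0 then complex.Re c else complex.Im c).
  exists A, t; split.
    by rewrite unitmxE unitfE det_mx22 !mxE /= -crossE.
  apply/funext => -[a b]; rewrite PsiE /affine_map; congr (_ + _).
  rewrite /complex_of_vec /real_comb !mxE !big_ord_recl !big_ord0 !mxE /=.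
  case: (u) (w) => u1 u2 [w1 w2].
  by apply/eqP; rewrite eq_complex /=; apply/andP; split; apply/eqP; ring.
Qed.

Lemma nonsingular_affine_comp Phi Psi :
  nonsingular_affine Phi -> nonsingular_affine Psi -> nonsingular_affine (Phi \o Psi).
Proof.
move=> /nonsingular_affineP[u [w [t [uw0 PhiE]]]].
move=> /nonsingular_affineP[u' [w' [t' [uw0' PsiE]]]].
apply/nonsingular_affineP.
exists (real_comb u w u'), (real_comb u w w'), (real_comb u w t' + t); split.
  by rewrite crossC_real_comb mulf_neq0.
move=> z; rewrite /= PhiE PsiE real_combD [RHS]addrA.
by rewrite [real_comb u' w' z]/real_comb real_combD !real_combZ.
Qed.

Lemma nonsingular_affine_inj Psi : nonsingular_affine Psi -> injective Psi.
Proof.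
move=> /nonsingular_affineP[u [w [t [uw0 PsiE]]]] x y; rewrite !PsiE => /addIr /eqP.
rewrite -subr_eq0 -real_combB => /eqP /(real_comb_eq0 uw0) /eqP.
by rewrite subr_eq0 => /eqP.
Qed.

Lemma nonsingular_affine_conv Psi x y (r : R) : nonsingular_affine Psi ->
  Psi (r%:C * x + (1 - r)%:C * y) = r%:C * Psi x + (1 - r)%:C * Psi y.
Proof.
move=> /nonsingular_affineP[u [w [t [_ PsiE]]]].
by rewrite !PsiE real_combD !real_combZ rmorphB rmorph1; ring.
Qed.

Lemma image_convex_hull Psi S : nonsingular_affine Psi ->
  Psi @` convex_hull S = convex_hull (Psi @` S).
Proof.
move=> Psi_aff; apply/seteqP; split.
- suff : convex_hull S `<=` Psi @^-1` convex_hull (Psi @` S).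
    by move=> sub _ [x Sx <-]; exact: sub.
  apply: convex_hull_min => [x y t t01 /= Sx Sy|x Sx].
    by rewrite nonsingular_affine_conv //; exact: convex_hull_closed.
  by apply: sub_convex_hull; exists x.
- apply: convex_hull_min => [_ _ t t01 [x Sx <-] [y Sy <-]|_ [x Sx <-]].
    rewrite -nonsingular_affine_conv //.
    by exists (t%:C * x + (1 - t)%:C * y) => //; exact: convex_hull_closed.
  by exists x => //; exact: sub_convex_hull.
Qed.

Lemma image_vertices_sub Psi P : nonsingular_affine Psi ->
  Psi @` vertices P `<=` vertices (Psi @` P).
Proof.
move=> Psi_aff _ [x [Px ext_x] <-]; split; first by exists x.
move=> _ _ t [y Py <-] [z Pz <-] t01; rewrite -nonsingular_affine_conv //.
move=> /(nonsingular_affine_inj Psi_aff) xyz.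
by have [-> ->] := ext_x y z t Py Pz t01 xyz.
Qed.

(** Serves to count the vertices of an affinely regular polygon and to place them in L. The image of
    the hull is the hull of the image, and extreme points are carried to extreme points. *)
Lemma vertices_affine_circle Psi S c (r : R) : nonsingular_affine Psi ->
  (forall x, S x -> sqn (x - c) = r) ->
  vertices (Psi @` convex_hull S) = Psi @` S.
Proof.
move=> Psi_aff Sr; apply/seteqP; split.
  by rewrite image_convex_hull //; exact: vertices_convex_hull_sub.
move=> _ [x Sx <-]; apply: image_vertices_sub => //.
by exists x => //; exact: circle_vertices Sr _ Sx.
Qed.

End Affine.

(** * Roots of unity and regular polygons *)

Section RootsOfUnity.
Variable R : realType.
Implicit Types (m k : nat) (x y z : R[i]).

Lemma sqn_real (r : R) : sqn r%:C = r ^+ 2.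
Proof. by rewrite /sqn /= expr0n addr0. Qed.

Lemma sqn1 : sqn (1 : R[i]) = 1.
Proof. by rewrite -[1]/(1%:C) sqn_real expr1n. Qed.

Lemma sqnX z k : sqn (z ^+ k) = sqn z ^+ k.
Proof.
by elim: k => [|k IHk]; rewrite ?expr0 ?sqn1 // !exprS sqnM IHk.
Qed.

Lemma sqn_unity_root z k : (0 < k)%N -> z ^+ k = 1 -> sqn z = 1.
Proof.
move=> k_gt0 zk1; apply/eqP; rewrite -(@pexpr_eq1 _ _ k) ?sqn_ge0 // -sqnX zk1.
by rewrite sqn1.
Qed.

Lemma add_conjcE z : z + z^* = (2 * complex.Re z)%:C.
Proof. by rewrite addcJ rmorphM rmorph_nat. Qed.

Lemma mulc_conj_unity z : sqn z = 1 -> z * z^* = 1.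
Proof. by rewrite -sqnE => ->. Qed.

Lemma crossCM z x y : crossC (z * x) (z * y) = sqn z * crossC x y.
Proof. by move: z x y => [? ?] [? ?] [? ?]; rewrite /crossC /sqn /=; ring. Qed.

Lemma dotCM z x y : dotC (z * x) (z * y) = sqn z * dotC x y.
Proof. by move: z x y => [? ?] [? ?] [? ?]; rewrite /dotC /sqn /=; ring. Qed.

(** De Moivre's formula, with the angle written as twice k pi / m to prepare the double-angle
    formulas. *)
Lemma zetaX m k : zeta R m ^+ k =
  cos ((k%:R * (pi / m%:R)) *+ 2) +i* sin ((k%:R * (pi / m%:R)) *+ 2).
Proof.
elim: k => [|k IHk]; first by rewrite expr0 mul0r mul0rn cos0 sin0.
have -> : (k.+1%:R * (pi / m%:R)) *+ 2 =
    (k%:R * (pi / m%:R)) *+ 2 + 2 * pi / m%:R :> R.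
  by rewrite -natr1 mulrDl mul1r mulrnDl; congr (_ + _);
     rewrite -[RHS]mulrA [RHS]mulr_natl.
rewrite exprSr IHk /zeta.
move: (k%:R * (pi / m%:R) *+ 2) (2 * pi / m%:R) => a b; rewrite (cosD a) (sinD a).
by apply/eqP; rewrite eq_complex /=; apply/andP; split; apply/eqP; ring.
Qed.

Lemma sin_fraction_gt0 m k : (0 < k < m)%N -> 0 < sin (k%:R * (pi / m%:R)) :> R.
Proof.
case/andP=> k_gt0 lt_km.
have m_gt0 : 0 < m%:R :> R by rewrite ltr0n (leq_ltn_trans _ lt_km).
apply: sin_gt0_pi; rewrite mulr_gt0 ?ltr0n ?divr_gt0 ?pi_gt0 //=.
by rewrite mulrCA gtr_pMr ?pi_gt0 // ltr_pdivrMr // mul1r ltr_nat.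
Qed.

Lemma zeta_unity m : (0 < m)%N -> zeta R m ^+ m = 1.
Proof.
move=> m_gt0; rewrite zetaX mulrCA divff ?pnatr_eq0 -?lt0n // mulr1.
by rewrite cos2pi sin2pi.
Qed.

Lemma zetaX_neq1 m k : (0 < k < m)%N -> zeta R m ^+ k != 1.
Proof.
move=> /sin_fraction_gt0 s_gt0; rewrite zetaX eq_complex negb_and /=.
apply/orP; left; rewrite cos_mulr2n cos2sin2.
apply/eqP => h; have := exprn_gt0 2 s_gt0; lra.
Qed.

Lemma primitive_root_intro (F : fieldType) (n : nat) (z : F) :
  (0 < n)%N -> z ^+ n = 1 -> (forall k, (0 < k < n)%N -> z ^+ k != 1) ->
  n.-primitive_root z.
Proof.
move=> n_gt0 zn1 zk; have [k prim_z] := prim_order_exists n_gt0 zn1.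
move=> /(dvdn_leq n_gt0); rewrite leq_eqVlt => /predU1P[<- // | lt_kn].
have := zk k; rewrite (prim_order_gt0 prim_z) lt_kn prim_expr_order // eqxx.
by move=> /(_ isT).
Qed.

Lemma zeta_primitive m : (0 < m)%N -> m.-primitive_root (zeta R m).
Proof.
move=> m_gt0; apply: primitive_root_intro => //; first exact: zeta_unity.
by move=> k; exact: zetaX_neq1.
Qed.

(** The cross product equals 4 sin(pi/m) sin(j pi/m) sin((j-1) pi/m), and all three angles lie
    strictly between 0 and pi. *)
Lemma zeta_convex m j : (1 < j < m)%N ->
  0 < crossC (zeta R m - 1) (zeta R m ^+ j - 1).
Proof.
case/andP=> j_gt1 lt_jm.
have s1 := @sin_fraction_gt0 m 1; have sj := @sin_fraction_gt0 m j.
have := @sin_fraction_gt0 m j.-1; rewrite -{1}[zeta R m]expr1 !zetaX.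
have -> : j.-1%:R * (pi / m%:R) = j%:R * (pi / m%:R) - 1%:R * (pi / m%:R) :> R.
  by rewrite -mulrBl -natrB ?subn1 // ltnW.
have := cos2Dsin2 (1%:R * (pi / m%:R) : R).
have := cos2Dsin2 (j%:R * (pi / m%:R) : R).
rewrite sinB !cos_mulr2n !sin_mulr2n.
move: (sin (1%:R * _)) (cos (1%:R * _)) s1 => s c.
move: (sin (j%:R * _)) (cos (j%:R * _)) sj => S C.
move=> sj s1 h1 h2 h3.
have s_gt0 : 0 < s by apply: s1; rewrite (ltn_trans j_gt1).
have S_gt0 : 0 < S by apply: sj; rewrite (ltn_trans _ j_gt1).
have {}h3 : 0 < S * c - C * s.
  apply: h3; rewrite -subn1 subn_gt0 j_gt1.
  by rewrite (leq_ltn_trans _ lt_jm) // leq_subr.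
have -> : crossC ((c ^+ 2 *+ 2 - 1) +i* ((c * s) *+ 2) - 1)
  ((C ^+ 2 *+ 2 - 1) +i* ((C * S) *+ 2) - 1) = 4 * s * S * (S * c - C * s).
  have cE : c ^+ 2 = 1 - s ^+ 2 by rewrite -h2; ring.
  have CE : C ^+ 2 = 1 - S ^+ 2 by rewrite -h1; ring.
  rewrite /crossC cE CE /=; ring.
by rewrite !mulr_gt0 // ltr0n.
Qed.

Section TraceField.
Variables (F : fieldType) (K : set F) (x y : F).
Hypotheses (fieldK : is_subfield K) (xy1 : x * y = 1) (Kxy : K (x + y)).

(** As xy = 1, the power sums satisfy s_(k+2) = (x + y) s_(k+1) - s_k; the induction carries two
    consecutive values. *)
Lemma subfield_trace_exp k : K (x ^+ k + y ^+ k).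
Proof.
suff [] : K (x ^+ k + y ^+ k) /\ K (x ^+ k.+1 + y ^+ k.+1) by [].
elim: k => [|k [IH0 IH1]].
  by rewrite !expr0 !expr1; split=> //; apply: subfieldD => //; exact: subfield1.
split=> //.
have -> : x ^+ k.+2 + y ^+ k.+2 =
    (x + y) * (x ^+ k.+1 + y ^+ k.+1) - x * y * (x ^+ k + y ^+ k).
  by rewrite !exprS; ring.
by rewrite xy1 mul1r; apply: subfieldB => //; exact: subfieldM.
Qed.

End TraceField.

(** Passes from one primitive root w to any n-th root of unity z: z is a power of w, and the
    conjugate of w is its inverse. *)
Lemma trace_primitive_root (K : set R[i]) n (w z : R[i]) : is_subfield K ->
  n.-primitive_root w -> K (w + w^*) -> z ^+ n = 1 -> K (z + z^*).
Proof.
move=> fieldK prim_w Kw /(prim_rootP prim_w)[j ->]; rewrite rmorphXn /=.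
apply: subfield_trace_exp => //; apply: mulc_conj_unity.
exact: sqn_unity_root (prim_order_gt0 prim_w) (prim_expr_order prim_w).
Qed.

End RootsOfUnity.

(** * Regular polygons as orbits of a rotation *)

Lemma val_iter_ordS n (i : 'I_n) k : iter k (@ordS n) i = ((i + k) %% n)%N :> nat.
Proof.
elim: k => [|k IHk] /=; first by rewrite addn0 modn_small.
by rewrite IHk -addn1 modnDml addn1 addnS.
Qed.

Lemma iter_ordS_neq n (i : 'I_n) k : (0 < k < n)%N -> iter k (@ordS n) i != i.
Proof.
case/andP=> k_gt0 lt_kn; apply/eqP => /(congr1 val) /=.
rewrite val_iter_ordS -[RHS](modn_small (ltn_ord i)) -[in RHS](addn0 i) => /eqP.
by rewrite eqn_modDl mod0n modn_small // gtn_eqF.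
Qed.

Section RegularPolygon.
Variables (R : realType) (n : nat) (v : 'I_n -> R[i]).
Hypotheses (n_ge3 : (3 <= n)%N) (v_convex : convex_position v).
Hypotheses (v_eqlat : equilateral v) (v_eqang : equiangular v).

Let e (i : 'I_n) := v (ordS i) - v i.

Let ordS_neq (i : 'I_n) : ordS i != i.
Proof. exact: (@iter_ordS_neq n i 1 (ltnW n_ge3)). Qed.

Let ordSS_neq (i : 'I_n) : ordS (ordS i) != i.
Proof. exact: (@iter_ordS_neq n i 2 n_ge3). Qed.

Lemma convex_position_edge i : 0 < crossC (e i) (e (ordS i)).
Proof.
have := v_convex (ordSS_neq i) (ordS_neq (ordS i)).
have -> // : crossC (v (ordS i) - v i) (v (ordS (ordS i)) - v i) =
  crossC (e i) (e (ordS i)).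
rewrite /e; move: (v i) (v (ordS i)) (v (ordS (ordS i))) => [a1 a2] [b1 b2] [c1 c2].
by rewrite /crossC /=; ring.
Qed.

Lemma convex_position_inj : injective v.
Proof.
move=> i k vik; apply/eqP; apply: contraT => ki.
have [kSi|kSi] := eqVneq k (ordS i).
  have := convex_position_edge i; rewrite /e -kSi vik subrr.
  by rewrite /crossC rmorph0 mul0r ltxx.
rewrite eq_sym in ki; have := v_convex ki kSi.
by rewrite vik subrr /crossC mulr0 ltxx.
Qed.

Let sqn_edge_gt0 i : 0 < sqn (e i).
Proof.
rewrite lt_def sqn_ge0 andbT sqn_eq0; apply/eqP => ei0.
by have := convex_position_edge i; rewrite ei0 /crossC rmorph0 mul0r ltxx.
Qed.

Let sqn_edge i j : sqn (e i) = sqn (e j).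
Proof.
have sqn_normc z : sqn z = Normc.normc z ^+ 2 :> R.
  by rewrite normc_sqn sqr_sqrtr ?sqn_ge0.
by rewrite !sqn_normc (v_eqlat i j).
Qed.

(** The edges have a common squared length l, so the angle between consecutive edges determines
    their dot product. *)
Let dot_edge i j : dotC (e i) (e (ordS i)) = dotC (e j) (e (ordS j)).
Proof.
pose l := sqn (e i); have l_gt0 : 0 < l by exact: sqn_edge_gt0.
(* The sides leaving the vertex are [- e k] and [e (ordS k)], hence the minus sign. *)
have angleE k : angle (v (ord_pred (ordS k))) (v (ordS k)) (v (ordS (ordS k))) =
    acos (- dotC (e k) (e (ordS k)) / l).
  rewrite ordSK /angle; congr acos.
  have -> : v k - v (ordS k) = - e k by rewrite opprB.
  rewrite !normc_sqn -(sqn_edge i (ordS k)).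
  have -> : sqn (- e k) = l.
    transitivity (sqn (e k)); last exact: sqn_edge.
    by rewrite /sqn; case: (e k) => a b /=; ring.
  rewrite -expr2 sqr_sqrtr ?ltW //; congr (_ / _).
  by rewrite /dotC mulNr raddfN.
(* [cos] undoes [acos] only on [-1, 1]; the bound is Cauchy-Schwarz, obtained from Lagrange's
   identity dot^2 + cross^2 = l^2. *)
have dot_itv k : - dotC (e k) (e (ordS k)) / l \in `[-1, 1].
  have : dotC (e k) (e (ordS k)) ^+ 2 <= l ^+ 2.
    have -> : l ^+ 2 = sqn (e k) * sqn (e (ordS k)).
      by rewrite (sqn_edge k i) (sqn_edge (ordS k) i) expr2.
    have -> : sqn (e k) * sqn (e (ordS k)) =
        dotC (e k) (e (ordS k)) ^+ 2 + crossC (e k) (e (ordS k)) ^+ 2.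
      case: (e k) (e (ordS k)) => a b [c d].
      by rewrite /sqn /dotC /crossC /=; ring.
    by rewrite lerDl sqr_ge0.
  rewrite -[leLHS]real_normK ?num_real // ler_pXn2r ?nnegrE ?normr_ge0 ?(ltW l_gt0) //.
  rewrite ler_norml in_itv /= => /andP[h1 h2].
  by rewrite ler_pdivlMr // ler_pdivrMr // mulN1r mul1r lerN2 h2 lerNl.
have := v_eqang (ordS i) (ordS j); rewrite !angleE.
move=> /(congr1 cos); rewrite !acosK ?dot_itv //.
by move/(mulIf (invr_neq0 (lt0r_neq0 l_gt0)))/oppr_inj.
Qed.

(** Lagrange's identity fixes the square of the cross product, and convexity fixes its sign. *)
Let cross_edge i j : crossC (e i) (e (ordS i)) = crossC (e j) (e (ordS j)).
Proof.
have sqE k : crossC (e k) (e (ordS k)) ^+ 2 =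
    sqn (e k) * sqn (e (ordS k)) - dotC (e k) (e (ordS k)) ^+ 2.
  case: (e k) (e (ordS k)) => a b [c d].
  by rewrite /sqn /dotC /crossC /=; ring.
apply/eqP; rewrite -(@eqrXn2 _ 2) ?ltW ?convex_position_edge //.
by rewrite !sqE (dot_edge i j) (sqn_edge i j) (sqn_edge (ordS i) (ordS j)).
Qed.

Let edge_rotation : exists w : R[i],
  [/\ w != 1, sqn w = 1 & forall j, e (ordS j) = w * e j].
Proof.
pose i := Ordinal (ltnW (ltnW n_ge3)).
pose l := sqn (e i); have l_gt0 : 0 < l by exact: sqn_edge_gt0.
(* The quotient of consecutive edges: conj(e_i) e_(i+1) has real part dot and imaginary part cross,
   both independent of i. *)
pose w := l^-1%:C * (dotC (e i) (e (ordS i)) +i* crossC (e i) (e (ordS i))).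
have ew j : e (ordS j) = w * e j.
  have : l%:C * e (ordS j) = 
      (dotC (e j) (e (ordS j)) +i* crossC (e j) (e (ordS j))) * e j.
    rewrite /l (sqn_edge i j); case: (e j) (e (ordS j)) => a b [c d].
    rewrite /sqn /dotC /crossC.
    by apply/eqP; rewrite eq_complex /=; apply/andP; split; apply/eqP; ring.
  rewrite (dot_edge j i) (cross_edge j i) /w -mulrA => <-.
  by rewrite mulrA -rmorphM mulVf ?gt_eqF // rmorph1 mul1r.
exists w; split=> //.
  apply/eqP => w1; have := ew i; rewrite w1 mul1r => ee.
  have := convex_position_edge i; rewrite ee.
  case: (e i) => a b; rewrite /crossC /=.
  by rewrite (_ : a * b + - b * a = 0) ?ltxx //; ring.
have : sqn (e (ordS i)) = sqn w * sqn (e i) by rewrite ew sqnM.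
rewrite (sqn_edge (ordS i) i) -{1}[sqn (e i)]mul1r.
by move/(mulIf (lt0r_neq0 l_gt0)).
Qed.

(** Each edge is w times the previous one, so the vertices are partial sums of a geometric
    progression. Closing up after n steps gives w^n = 1; distinctness of the vertices gives
    primitivity. *)
Lemma regular_polygon_vertices : exists c a w : R[i],
  [/\ n.-primitive_root w, a != 0 & forall k : 'I_n, v k = c + a * w ^+ k].
Proof.
have [w [w_neq1 w_unit ew]] := edge_rotation.
pose i0 := Ordinal (ltnW (ltnW n_ge3)); pose u k := iter k (@ordS n) i0.
have w1_neq0 : w - 1 != 0 by rewrite subr_eq0.
(* With this a the k-th edge is a w^k (w - 1), so the sum telescopes; c is the centre. *)
pose a := e i0 / (w - 1); pose c := v i0 - a.
have eE k : e (u k) = w ^+ k * e i0.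
  by elim: k => [|k IHk]; rewrite ?mul1r // [u _]/= ew IHk mulrA -exprS.
have vE k : v (u k) = c + a * w ^+ k.
  elim: k => [|k IHk]; first by rewrite mulr1 subrK.
  have -> : v (u k.+1) = e (u k) + v (u k) by rewrite /e subrK.
  have -> : e (u k) = a * w ^+ k * (w - 1).
    by rewrite eE /a mulrAC divfK // mulrC.
  by rewrite IHk exprSr; ring.
have uE (k : 'I_n) : u k = k.
  by apply: val_inj; rewrite /= val_iter_ordS add0n modn_small.
have a_neq0 : a != 0.
  by rewrite mulf_neq0 ?invr_neq0 // -sqn_eq0 gt_eqF.
have wX1 k : (w ^+ k == 1) = (v (u k) == v i0).
  rewrite -[v i0]/(v (u 0)) !vE expr0 mulr1 (inj_eq (addrI _)).
  by rewrite -[X in _ = (_ == X)]mulr1 (inj_eq (mulfI a_neq0)).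
have n_gt0 : (0 < n)%N by exact: ltnW (ltnW n_ge3).
exists c, a, w; split=> // [|k]; last by rewrite -vE uE.
apply: primitive_root_intro => // [|k k_n].
  apply/eqP; rewrite wX1; apply/eqP; congr v; apply: val_inj.
  by rewrite /= val_iter_ordS add0n modnn.
by rewrite wX1 (inj_eq convex_position_inj) iter_ordS_neq.
Qed.

End RegularPolygon.

(** * Affinely regular polygons in L *)

Section Main.
Variable R : realType.
Implicit Types (L P K : set R[i]) (m n : nat).

Lemma card_range_ord n (T : Type) (f : 'I_n -> T) :
  injective f -> (range f #= `I_n)%card.
Proof.
move=> f_inj; apply: card_eq_trans (card_esym card_II).
by apply: inj_card_eq => x y _ _; exact: f_inj.
Qed.

Lemma K_Lambda_subB L x y : L x -> L y -> K_Lambda L (x - y).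
Proof. by move=> Lx Ly; apply: sub_gen_smallest; left; exists x => //; exists y. Qed.

Lemma affinely_regular_gon_root L m P :
  affinely_regular_gon m P -> polygon_in L P ->
  (3 <= m)%N /\ exists w, m.-primitive_root w /\ K_Lambda L (w + w^*).
Proof.
move=> [[Psi Psi_aff [Q [n [v [n_ge3 v_conv v_eqlat v_eqang ->]]] ->]] cardP].
move=> [_ PL].
have [c [a [w [prim_w a_neq0 vE]]]] :=
  regular_polygon_vertices n_ge3 v_conv v_eqlat v_eqang.
have n_gt0 := prim_order_gt0 prim_w; have wn := prim_expr_order prim_w.
have w_unit : sqn w = 1 by exact: sqn_unity_root n_gt0 wn.
have vertP : vertices (Psi @` convex_hull (range v)) = Psi @` range v.
  apply: (@vertices_affine_circle _ Psi _ c (sqn a)) => // _ [k _ <-].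
  by rewrite vE addrC addKr sqnM sqnX w_unit expr1n mulr1.
(* The regular polygon comes with its own number n of vertices; counting the vertices of the image
   identifies it with m. *)
have <- : n = m.
  apply/card_eq_II; apply: card_eq_trans cardP; apply: card_esym.
  rewrite vertP image_comp; apply: card_range_ord.
  exact: inj_comp (nonsingular_affine_inj Psi_aff) (convex_position_inj n_ge3 v_conv).
split=> //; exists w; split=> //.
have LPsi k : L (Psi (c + a * w ^+ k)).
  apply: PL; rewrite vertP; exists (c + a * w ^+ k) => //.
  exists (Ordinal (ltn_pmod k n_gt0)) => //.
  by rewrite vE /= expr_mod.
have /nonsingular_affineP[u [u' [t [uu' PsiE]]]] := Psi_aff.
(* The k-th edge of the affine image: the translation cancels, so [d k] is a difference of two
   points of L. *)
pose d k := real_comb u u' (a * w ^+ k * (w - 1)).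
have Kd k : K_Lambda L (d k).
  have -> : d k = Psi (c + a * w ^+ k.+1) - Psi (c + a * w ^+ k).
    rewrite !PsiE opprD addrACA subrr addr0 -real_combB /d; congr real_comb.
    by rewrite exprSr; ring.
  exact: K_Lambda_subB.
have d1_neq0 : d 1 != 0.
  apply/eqP => /(real_comb_eq0 uu')/eqP; rewrite !mulf_eq0 (negPf a_neq0) expr1.
  have w_neq1 : w != 1.
    apply/eqP => w1; have := prim_order_dvd prim_w 1; rewrite w1 expr1n eqxx dvdn1.
    by move=> /eqP n1; rewrite n1 in n_ge3.
  by rewrite (prim_root_eq0 prim_w) gtn_eqF // subr_eq0 (negPf w_neq1).
(* w^2 + 1 = w (w + conj w) as |w| = 1, and the real factor w + conj w passes through
   [real_comb]. *)
have -> : w + w^* = (d 2 + d 0) / d 1.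
  apply: (canRL (mulfK d1_neq0)); rewrite add_conjcE -real_combZ -add_conjcE.
  rewrite -real_combD; congr real_comb.
  have ww : w * w^* = 1 by exact: mulc_conj_unity.
  transitivity (a * (w ^+ 2 + w * w^*) * (w - 1)); first by ring.
  by rewrite ww; ring.
have fieldK : is_subfield (K_Lambda L) by exact: adjoinQ_subfield.
by apply: (subfield_div fieldK) => //; exact: (subfieldD fieldK).
Qed.

Lemma k_cyclo_sub L m w : m.-primitive_root w -> K_Lambda L (w + w^*) ->
  k_cyclo R m `<=` k_Lambda L.
Proof.
move=> prim_w Kw; apply: smallest_sub; first exact/realsCI_subfield/adjoinQ_subfield.
move=> _ ->; split; last by exists (2 * complex.Re (zeta R m)); rewrite ?add_conjcE.
apply: (trace_primitive_root _ prim_w Kw); first exact: adjoinQ_subfield.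
exact: zeta_unity (prim_order_gt0 prim_w).
Qed.

(** Multiplication by z^i is a rotation taking the vertex 1 to z^i, so each condition at z^i reduces
    to the one at 1. *)
Lemma zeta_regular m : (3 <= m)%N ->
  regular_polygon (convex_hull (range (fun k : 'I_m => zeta R m ^+ k))).
Proof.
move=> m_ge3; have m_gt0 : (0 < m)%N by apply: leq_trans m_ge3.
set z := zeta R m; have zm : z ^+ m = 1 := zeta_unity R m_gt0.
have z_unit : sqn z = 1 := sqn_unity_root m_gt0 zm.
have zX_unit k : sqn (z ^+ k) = 1 by rewrite sqnX z_unit expr1n.
have zS (i : 'I_m) : z ^+ ordS i = z ^+ i * z by rewrite /= expr_mod // exprSr.
have zP (i : 'I_m) : z ^+ ord_pred i = z ^+ i * z^*.
  rewrite -{2}(ord_predK i) zS -mulrA.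
  by rewrite mulc_conj_unity // mulr1.
exists m, (fun k => z ^+ k); split=> //.
- move=> i k ki kSi.
  (* j is the number of steps from i to k around the cycle, k - i or m + k - i; k distinct from i
     and its successor means 1 < j < m. *)
  have [j j_lt zkE] : exists2 j, (1 < j < m)%N & z ^+ k = z ^+ i * z ^+ j.
    have [lt_ik | le_ki] := ltnP i k.
      exists (k - i)%N; last by rewrite -exprD subnKC // ltnW.
      rewrite (leq_ltn_trans (leq_subr _ _) (ltn_ord k)) andbT ltn_subRL addn1.
      rewrite ltn_neqAle lt_ik andbT; apply: contra kSi => /eqP iSk.
      by apply/eqP/val_inj; rewrite /= iSk modn_small.
    have {le_ki} lt_ki : (k < i)%N by rewrite ltn_neqAle ki.
    exists (m + k - i)%N; last first.
      rewrite -exprD subnKC; first by rewrite exprD zm mul1r.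
      by rewrite (leq_trans (ltnW (ltn_ord i))) // leq_addr.
    apply/andP; split; last first.
      rewrite ltn_subLR; first by rewrite [(i + m)%N]addnC ltn_add2l.
      by rewrite (leq_trans (ltnW (ltn_ord i))) // leq_addr.
    rewrite ltn_subRL addn1 ltn_neqAle (leq_trans (ltn_ord i)) ?leq_addr // andbT.
    apply: contra kSi => /eqP iSmk; apply/eqP/val_inj => /=.
    by rewrite iSmk modnDl modn_small.
  rewrite zkE zS -{2 4}[z ^+ i]mulr1 -!mulrBr crossCM zX_unit mul1r.
  exact: zeta_convex.
- move=> i j.
  rewrite !zS -{2}[z ^+ i]mulr1 -{2}[z ^+ j]mulr1 -!mulrBr.
  by rewrite !normc_sqn !sqnM !zX_unit.
- suff angleE (i : 'I_m) : angle (z ^+ ord_pred i) (z ^+ i) (z ^+ ordS i) =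
      angle z^* 1 z by move=> i j; rewrite !angleE.
  rewrite /angle zS zP -{2 4 6 8}[z ^+ i]mulr1 -!mulrBr dotCM.
  by rewrite !normc_sqn !sqnM zX_unit !mul1r.
Qed.

Lemma affinely_regular_gon_exists L m : ~ degenerate L -> prop_Aff L -> (3 <= m)%N ->
  K_Lambda L (zeta R m + (zeta R m)^*) ->
  exists P, affinely_regular_gon m P /\ polygon_in L P.
Proof.
move=> ndeg aff m_ge3 Kz; have m_gt0 : (0 < m)%N by apply: leq_trans m_ge3.
set z := zeta R m in Kz *.
have fieldK : is_subfield (K_Lambda L) by exact: adjoinQ_subfield.
have z_unit : sqn z = 1 := sqn_unity_root m_gt0 (zeta_unity R m_gt0).
have [tau Ktau Im_tau] : exists2 tau, K_Lambda L tau & complex.Im tau != 0.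
  apply: contrapT => real_tau; apply: ndeg => -[a b] Kab.
  exists a => //; have [-> // | b_neq0] := eqVneq b 0.
  by case: real_tau; exists (a +i* b).
(* If z were real, z - 1 and z^2 - 1 = (z - 1)(z + 1) would be parallel, against [zeta_convex] with
   j = 2. *)
have Im_z : complex.Im z != 0.
  apply/eqP => Im_z; have := @zeta_convex R m 2 m_ge3; rewrite -/z.
  rewrite -[z - 1]mulr1 (_ : z ^+ 2 - 1 = (z - 1) * (z + 1)); last by ring.
  rewrite crossCM /crossC; case: (z) Im_z => a b /= ->.
  by rewrite !(addr0, mulr0, mul0r, oppr0) ltxx.
(* real_comb 1 w fixes the reals and sends z to Re z + tau. *)
pose w := (complex.Im z)^-1%:C * tau; pose f k := real_comb 1 w (z ^+ k).
have cross1w : crossC 1 w != 0.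
  rewrite (_ : crossC 1 w = (complex.Im z)^-1 * complex.Im tau) ?mulf_neq0 ?invr_neq0 //.
  by rewrite /crossC /w; case: (tau) => a b /=; ring.
have Kf k : K_Lambda L (f k).
  (* The recurrence z^(k+2) = (z + conj z) z^(k+1) - z^k has real coefficients in [K_Lambda L] and
     survives the R-linear map; the initial values are 1 and Re z + tau. *)
  suff [] : K_Lambda L (f k) /\ K_Lambda L (f k.+1) by [].
  elim: k => [|k [IH0 IH1]].
    have -> : f 0 = 1 by rewrite /f expr0 /real_comb mulr1 mul0r addr0.
    have -> : f 1 = (z + z^*) / 2 + tau.
      rewrite /f expr1 /real_comb mulr1 /w mulrA -rmorphM mulfV // mul1r.
      by rewrite ReJ_add.
    have K1 := subfield1 fieldK; split=> //; apply: (subfieldD fieldK) => //.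
    by apply: (subfield_div fieldK) => //; exact: (subfieldD fieldK K1 K1).
  split=> //.
  have -> : f k.+2 = (z + z^*) * f k.+1 - f k.
    rewrite /f add_conjcE -real_combZ -real_combB; congr real_comb.
    have zz := mulc_conj_unity z_unit.
    rewrite -add_conjcE !exprS -[X in _ = _ - X]mul1r -zz; ring.
  by apply: (subfieldB fieldK) => //; exact: (subfieldM fieldK).
have [Phi Phi_aff PhiL] : exists2 Phi, nonsingular_affine Phi &
    Phi @` range (fun k : 'I_m => f k) `<=` L.
  by apply: aff => [|_ [k _ <-] //]; exact: finite_image.
have lin_aff : nonsingular_affine (real_comb 1 w).
  by apply/nonsingular_affineP; exists 1, w, 0; split=> // x; rewrite addr0.
have Psi_aff := nonsingular_affine_comp Phi_aff lin_aff.
set Psi := Phi \o real_comb 1 w in Psi_aff.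
pose v (k : 'I_m) := z ^+ k.
have vertP : vertices (Psi @` convex_hull (range v)) = Psi @` range v.
  apply: (@vertices_affine_circle _ Psi _ 0 1) => // _ [k _ <-].
  by rewrite subr0 sqnX z_unit expr1n.
exists (Psi @` convex_hull (range v)); split; split.
- exists Psi => //; exists (convex_hull (range v)) => //; exact: zeta_regular.
- rewrite vertP image_comp; apply: card_range_ord.
  apply: inj_comp (nonsingular_affine_inj Psi_aff) _ => i j /eqP.
  rewrite (eq_prim_root_expr (zeta_primitive R m_gt0)) !modn_small // => /eqP.
  exact: val_inj.
- exists (Psi @` range v); last exact: image_convex_hull.
  by apply: finite_image; exact: finite_image.
- by rewrite vertP => _ [_ [k _ <-] <-]; apply: PhiL; exists (f k) => //; exists k.
Qed.

Lemma zeta_trace_finite_degree K : finite_degreeQ K -> is_subfield K ->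
  exists N, forall m, (0 < m)%N -> K (zeta R m + (zeta R m)^*) -> (m <= N)%N.
Proof.
(* The relation p for the trace has size at most d + 1, so q for zeta has size below 2(d + 1). This
   bounds phi(m) by 2(d + 1), the value fed to [totient_le_bounded]. *)
move=> [d [e [_ span_e]]] fieldK; exists ((d.+1.*2).+1`! ^ d.+1.*2)%N => m m_gt0 Kx.
apply: totient_le_bounded; set z := zeta R m in Kx *; set x := z + z^* in Kx.
have prim_z := zeta_primitive R m_gt0.
have [c cE] := choice (fun k : nat => span_e (x ^+ k) (subfieldX fieldK k Kx)).
have [p [p_neq0 szp px]] := linear_dependence_powers (fun k : 'I_d.+1 => cE k).
have z_neq0 : z != 0 by rewrite (prim_root_eq0 prim_z) -lt0n.
have zV : z^* = z^-1.
  apply: (mulfI z_neq0); rewrite mulfV // mulc_conj_unity //.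
  exact: sqn_unity_root m_gt0 (zeta_unity R m_gt0).
have xE : x = z + z^-1 by rewrite -zV.
rewrite xE in px; have [q [q_neq0 szq qz]] := root_addV z_neq0 p_neq0 px.
apply: ltnW; apply: leq_trans (totient_lt_size prim_z q_neq0 qz) _.
by apply: leq_trans (ltnW szq) _; rewrite leq_double.
Qed.

End Main.

Theorem theorem3p3 (R : realType) (L : set R[i])
    (hL : ~ degenerate L) (hAff : prop_Aff L) :
  (forall m : nat, (3 <= m)%N ->
     (exists P : set R[i], affinely_regular_gon m P /\ polygon_in L P) <->
     k_cyclo R m `<=` k_Lambda L) /\
  (prop_Alg L ->
     finite_set [set m : nat | exists P : set R[i],
                                 affinely_regular_gon m P /\ polygon_in L P]).
Proof.
have necessary m (P : set R[i]) : affinely_regular_gon m P -> polygon_in L P ->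
    (3 <= m)%N /\ k_cyclo R m `<=` k_Lambda L.
  move=> gonP PL; have [m_ge3 [w [prim_w Kw]]] := affinely_regular_gon_root gonP PL.
  by split=> //; exact: k_cyclo_sub prim_w Kw.
have trace_in m : k_cyclo R m `<=` k_Lambda L ->
    K_Lambda L (zeta R m + conjc (zeta R m)).
  by move=> km; have [] := km _ (sub_gen_smallest (erefl _)).
split=> [m m_ge3|algL].
  split=> [[P [gonP PL]]|/trace_in]; first by have [] := necessary m P gonP PL.
  exact: affinely_regular_gon_exists.
have [N bound_N] := zeta_trace_finite_degree algL (adjoinQ_subfield _).
apply: (@sub_finite_set _ _ `I_N.+1) (finite_II _) => m [P [gonP PL]].
(* The set ranges over all natural numbers m; the existence of the polygon itself gives m >= 3. *)
have [m_ge3 km] := necessary m P gonP PL.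
by rewrite /= ltnS; apply: bound_N; [exact: leq_trans m_ge3 | exact: trace_in].
Qed.
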